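(* Let $S_1,S_2$ be arbitrary non-negative real random variables (fading distributions), and let $\mathcal O(S_1,S_2)$ and $\mathcal A(S_1,S_2)$ be the outer bound region and the binary expansion superposition achievable region of the fading Gaussian broadcast channel $(S_1,S_2)$ (both defined in the context). Then for every $(R_1,R_2)\in\mathcal O(S_1,S_2)$, $$\bigl((R_1-6.386)^+,\ (R_2-6.386)^+\bigr)\in\mathcal A(S_1,S_2).$$ That is, irrespective of the fading distributions, the achievable region is within $6.386$ bits/s/Hz per user of the outer bound to the capacity region.
   Context: Notation: $x^+=\max(0,x)$; $\overline F_S(s)=\Pr[S\ge s]$; $\log$ is to base 2; $H(p)=-p\log p-(1-p)\log(1-p)$ is the binary entropy function; $Q(x)=\Pr[Z\ge x]$ for $Z\sim\mathcal N(0,1)$. The fading Gaussian broadcast channel $(S_1,S_2)$ is $\tilde Y_i=\sqrt{S_i}\,e^{j\theta_i}\tilde X+\tilde Z_i$, $i=1,2$, with complex input $\tilde X$ of unit average power, $\tilde Z_i\sim\mathcal{CN}(0,1)$, and states $(S_i,\theta_i)$ i.i.d. in time, known at receiver $i$ and unknown at the transmitter. The region $\mathcal O(S_1,S_2)$ is an outer bound to its capacity region and the region $\mathcal A(S_1,S_2)$ is achievable. Outer bound region: for $\omega\ge0$ let $\mathcal I_1(\omega)=\{s\ge0:\overline F_{S_1}(s)>\omega\overline F_{S_2}(s)\}$ and $\mathcal I_2(\omega)=\{s\ge0:\overline F_{S_1}(s)\le\omega\overline F_{S_2}(s)\}$, and $R_i^*(\omega)=\log e\int_{\mathcal I_i(\omega)}\overline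 F_{S_i}(s)\frac{1}{1+s}\,ds\in[0,\infty]$ for $i=1,2$. Then $\mathcal O(S_1,S_2)$ is the closure of the convex hull of $\bigcup_{\omega\ge0}\{(R_1,R_2)\in[0,\infty)^2: R_1\le R_1^*(\omega),\ R_2\le R_2^*(\omega)\}$. Achievable region: let $G(x)=xQ(x)-\frac1{\sqrt{2\pi}}e^{-x^2/2}$; for $a>0$ let $\epsilon_0(a)=\frac{G(2\sqrt a)-G(0)}{\sqrt a}$, with $\epsilon_0(0)=1$ (the limit as $a\downarrow0$); let $\hat\epsilon_0(a)=\min[1/2,\epsilon_0(a)]$ and $\hat H_0(a)=1-H(\hat\epsilon_0(a))$. Then $\mathcal A(S_1,S_2)$ is the closure of the convex hull (time sharing) of the union, over all partitions $\hat{\mathcal N}_1\cup\hat{\mathcal N}_2$ of $\{1,2,\ldots\}$ into two disjoint (possibly empty) sets, of the sets $\{(R_1,R_2)\in[0,\infty)^2: R_i\le 2\sum_{n\in\hat{\mathcal N}_i}\mathbb E[\hat H_0(3S_i2^{-2n})],\ i=1,2\}$. *)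

(* Defs.v *)
From mathcomp Require Import all_boot all_order all_algebra.
From mathcomp Require Import all_classical all_reals all_analysis.

Set Implicit Arguments.
Unset Strict Implicit.
Unset Printing Implicit Defensive.

Import Order.TTheory GRing.Theory Num.Theory.
Import numFieldNormedType.Exports.

Local Open Scope classical_set_scope.
Local Open Scope ring_scope.

Section special_functions.
Context {R : realType}.
Implicit Types p x a : R.

Definition log2 x : R := ln x / ln 2.

(* [ln 0 = 0], hence the usual convention 0 log 0 = 0. *)
Definition binary_entropy p : R := - (p * log2 p) - (1 - p) * log2 (1 - p).

Definition gaussQ x : R := fine (normal_prob (0 : R) 1 `[x, +oo[).

Definition gaussG x : R :=
  x * gaussQ x - (Num.sqrt (2 * pi))^-1 * expR (- (x ^+ 2 / 2)).

(* Meaningful for [0 <= a] only; the value at 0 is the limit from the right. *)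
Definition eps0 a : R :=
  if a == 0 then 1
  else (gaussG (2 * Num.sqrt a) - gaussG 0) / Num.sqrt a.

Definition eps0_hat a : R := Num.min (1 / 2) (eps0 a).

Definition H0_hat a : R := 1 - binary_entropy (eps0_hat a).

End special_functions.

Section regions.
Context {R : realType}.

(* The carrier is written [R^o * R^o] so that [R * R], with its product
   topology, is seen as a vector space over [R], as [convex_set] requires. *)
Definition rate_rectangle (M1 M2 : \bar R) : set (R^o * R^o) :=
  [set r | [/\ 0 <= r.1, 0 <= r.2, (r.1%:E <= M1)%E & (r.2%:E <= M2)%E]].

Definition convex_hull (A : set (R^o * R^o)) : set (R^o * R^o) :=
  smallest [set B : set (R^o * R^o) | convex_set B] A.

Context {d : measure_display} {T : measurableType d} {P : probability T R}.
Implicit Types S : {RV P >-> R}.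

(* Unlike the library's [ccdf], this is Pr[S >= s], not Pr[S > s]. *)
Definition tail S (s : R) : \bar R := distribution P S `[s, +oo[.

Definition rate_log_integral (I : set R) S : \bar R :=
  ((log2 (expR 1))%:E *
   \int[lebesgue_measure]_(s in I) (tail S s * ((1 + s)^-1)%:E))%E.

Definition outer_set1 S1 S2 (w : R) : set R :=
  [set s | 0 <= s /\ (tail S1 s > w%:E * tail S2 s)%E].

Definition outer_set2 S1 S2 (w : R) : set R :=
  [set s | 0 <= s /\ (tail S1 s <= w%:E * tail S2 s)%E].

Definition outer_region S1 S2 : set (R^o * R^o) :=
  closure (convex_hull (\bigcup_(w in [set w : R | 0 <= w])
    rate_rectangle (rate_log_integral (outer_set1 S1 S2 w) S1)
                   (rate_log_integral (outer_set2 S1 S2 w) S2))).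

Definition level_rate S (n : nat) : \bar R :=
  'E_P[fun t => H0_hat (3 * S t * 2 ^- (2 * n))].

Definition superposition_rate S (N : set nat) : \bar R :=
  (2%:E * \esum_(n in N) level_rate S n)%E.

Definition achievable_region S1 S2 : set (R^o * R^o) :=
  closure (convex_hull (\bigcup_(N in [set N : set nat * set nat |
      N.1 `|` N.2 = [set n | (0 < n)%N] /\ N.1 `&` N.2 = set0])
    rate_rectangle (superposition_rate S1 N.1) (superposition_rate S2 N.2))).

End regions.

(* Main.v *)
(** Cut the half-line into the octaves [2^k, 2^(k+1)); level n of the binary
    expansion serves the octaves 2n-1 and 2n. Any measurable splitting of the
    half-line between the users (the outer bound uses a threshold on the ratio
    of the tails) gives user i a share of each octave for the measure
    log e ds / (1 + s), of which an octave has at most one bit. Give level n to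
    user 1 for half of its share of the two octaves: as the shares of the two
    users add up to at most one, this is a time sharing of partitions.

    The tails decrease, so the outer rate of a user is at most
    log 3 + sum_k share_k Pr[S >= 2^k], where log 3 pays for s < 2. The loss
    of level n is therefore bounded by the expectation of
    1[x >= 1/2] + 1[x >= 1] - 2 H0_hat(3x) at x = S / 4^n. The Mills ratio
    bound and pi >= 3 give eps0(3x) <= q := (18x)^(-1/2), and
    H(q) <= h(q) := q (log(1/q) + log e). Multiplying x by 4 halves q, and
    h(q) = F(q) - F(q/2) for F(q) = 2q (log(1/q) + log e + 1), so the losses
    telescope, for every value of S, to at most
    max(2 F(1/4), 1 + 2 F(1/6)) <= 9/2. The total gap is at most
    log 3 + 9/2 <= 6.1, and 0.1 more truncates the outer integral to finitely
    many octaves. *)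

Require Import Defs.
From mathcomp Require Import all_boot all_order all_algebra.
From mathcomp Require Import all_classical all_reals all_analysis.
From mathcomp Require Import measurable_realfun.
From mathcomp Require Import zify ring lra.

Set Implicit Arguments.
Unset Strict Implicit.
Unset Printing Implicit Defensive.

Import Order.TTheory GRing.Theory Num.Theory.
Import numFieldNormedType.Exports.

Local Open Scope classical_set_scope.
Local Open Scope ring_scope.

(** * Logarithms, pi and binary entropy *)

Section real_estimates.
Context {R : realType}.
Implicit Types p q x y a : R.

Lemma ln_le_subr1 x : 0 < x -> ln x <= x - 1.
Proof.
move=> x0; have := @le_ln1Dx R (x - 1).
by rewrite [1 + _]addrC subrK; apply; rewrite ltrBrDl subrr.
Qed.

Lemma subr1V_le_ln x : 0 < x -> 1 - x^-1 <= ln x.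
Proof.
move=> x0; have := @ln_le_subr1 x^-1; rewrite invr_gt0 lnV ?posrE// => /(_ x0).
lra.
Qed.

(** From [ln x >= 1 - 1/x] at 15/14 and [(15/14)^10 <= 2]. *)
Lemma ln2_ge23 : 2 / 3 <= ln 2 :> R.
Proof.
have h15 : 1 / 15 <= ln (15 / 14) :> R.
  by apply: le_trans (subr1V_le_ln _); lra.
have h10 : 10 * ln (15 / 14) <= ln 2 :> R.
  rewrite mulr_natl -lnXn ?ler_ln ?posrE ?exprn_gt0//; lra.
lra.
Qed.

Lemma ln2_gt0 : 0 < ln 2 :> R.
Proof. by have := ln2_ge23; lra. Qed.

(** Since 3^5 = 243 <= 256 = 2^8. *)
Lemma ln3_le : ln 3 <= 8 / 5 * ln 2 :> R.
Proof.
have : ln (3 ^+ 5) <= ln (2 ^+ 8) :> R.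
  by rewrite ler_ln ?posrE ?exprn_gt0//; lra.
rewrite !lnXn// -[ln 3 *+ 5]mulr_natl -[ln 2 *+ 8]mulr_natl; lra.
Qed.

Lemma log2_expR1 : log2 (expR 1) = (ln 2)^-1 :> R.
Proof. by rewrite /log2 expRK mul1r. Qed.

Lemma sin_le_id x : 0 <= x -> sin x <= x.
Proof.
rewrite le_eqVlt => /predU1P[<-|x0]; first by rewrite sin0.
have [c _] : exists2 c, c \in `]0, x[ & sin x - sin 0 = cos c * (x - 0).
  apply: MVT => //.
  exact/continuous_subspaceT/continuous_sin.
rewrite sin0 !subr0 => ->.
by rewrite ler_piMl ?cos_le1// ltW.
Qed.

(** The cosine decreases on [0, pi] and vanishes at pi/2, so it suffices that [cos (3/2) > 0]. The
    triple-angle formula gives c (4 c^2 - 3) with c = cos (1/2) >= 7/8, and 4 (7/8)^2 > 3. *)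
Lemma pi_ge3 : 3 <= pi :> R.
Proof.
have hs : sin (1 / 4) <= 1 / 4 :> R by apply: sin_le_id; lra.
have hs0 : 0 <= sin (1 / 4) :> R.
  by apply/ltW/sin2_gt0; lra.
have hc : 7 / 8 <= cos (1 / 2) :> R.
  have -> : 1 / 2 = (1 / 4) *+ 2 :> R by rewrite [RHS]mulr2n; lra.
  rewrite cos_mulr2n [_ ^+ 2 *+ 2]mulr2n.
  have : sin (1 / 4) ^+ 2 <= (1 / 4) ^+ 2 :> R by rewrite ler_sqr ?nnegrE//; lra.
  have := cos2Dsin2 (1 / 4 : R); lra.
have : 0 < cos (3 / 2) :> R.
  have -> : 3 / 2 = 1 / 2 + (1 / 2) *+ 2 :> R by rewrite [_ *+ 2]mulr2n; lra.
  rewrite cosD cos_mulr2n sin_mulr2n [cos _ ^+ 2 *+ 2]mulr2n.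
  rewrite [_ * sin _ *+ 2]mulr2n.
  have h := cos2Dsin2 (1 / 2 : R).
  have c1 := cos_le1 (1 / 2 : R).
  move: (cos _) (sin _) h hc c1 => c s h hc c1.
  have -> : c * (c ^+ 2 + c ^+ 2 - 1) - s * (c * s + c * s) = c * (4 * c ^+ 2 - 3).
    have -> : s * (c * s + c * s) = c * 2 * s ^+ 2 by ring.
    have -> : s ^+ 2 = 1 - c ^+ 2 by rewrite -h; ring.
    ring.
  apply: mulr_gt0; nra.
rewrite -(@cos_pihalf R) ltr_cos ?in_itv/=; first lra.
- by apply/andP; split; have := pi_ge2 R; have := pi_gt0 R; lra.
- by apply/andP; split; have := pi_ge2 R; lra.
Qed.


(* The entropy upper bound [p log(1/p) + p log e]; its sums along halving
   arguments telescope through [dyadic_entropy_bound]. *)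
Definition entropy_bound p := p * (1 - ln p) / ln 2.

Definition dyadic_entropy_bound p := 2 * (p * (1 + ln 2 - ln p)) / ln 2.

(** Iterated, this exhibits [dyadic_entropy_bound p] as the sum of [entropy_bound] over p, p/2, p/4,
    ... *)
Lemma dyadic_entropy_boundE p : 0 < p ->
  dyadic_entropy_bound p = entropy_bound p + dyadic_entropy_bound (p / 2).
Proof.
move=> p0; rewrite /dyadic_entropy_bound /entropy_bound -mulrDl.
congr (_ / _); rewrite ln_div ?posrE//; lra.
Qed.

(** Monotonicity up to the maximum at e^(C-1), without derivatives: the increment is (q - p)(C - ln
    q) - p ln (q/p), and p ln (q/p) <= q - p. *)
Lemma ler_mul_subr_ln C p q : 0 < p -> p <= q -> ln q <= C - 1 ->
  p * (C - ln p) <= q * (C - ln q).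
Proof.
move=> p0 pq hq; have q0 : 0 < q by apply: lt_le_trans pq.
have h : p * ln (q / p) <= q - p.
  have -> : q - p = p * (q / p - 1) by field; rewrite gt_eqF.
  by apply: ler_wpM2l; [exact: ltW|rewrite ln_le_subr1 ?divr_gt0].
move: h; rewrite ln_div ?posrE// => h.
have : 0 <= (q - p) * (C - 1 - ln q) by rewrite mulr_ge0// subr_ge0.
nra.
Qed.

Lemma entropy_bound_ge0 p : 0 < p -> p <= 1 -> 0 <= entropy_bound p.
Proof.
move=> p0 p1; rewrite /entropy_bound divr_ge0 ?(ltW ln2_gt0)//.
rewrite mulr_ge0 ?(ltW p0)//.
have := ln_le0 p1; lra.
Qed.

Lemma ler_entropy_bound p q : 0 < p -> p <= q -> q <= 1 ->
  entropy_bound p <= entropy_bound q.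
Proof.
move=> p0 pq q1; rewrite ler_pM2r ?invr_gt0 ?ln2_gt0//.
by apply: ler_mul_subr_ln; rewrite ?subrr ?ln_le0.
Qed.

Lemma ler_dyadic_entropy_bound p q : 0 < p -> p <= q -> q <= 1 ->
  dyadic_entropy_bound p <= dyadic_entropy_bound q.
Proof.
move=> p0 pq q1; rewrite ler_pM2r ?invr_gt0 ?ln2_gt0//.
rewrite ler_pM2l//; apply: ler_mul_subr_ln => //.
have := ln_le0 q1; have := ln2_gt0; lra.
Qed.

Lemma dyadic_entropy_bound_ge0 p : 0 < p -> p <= 1 ->
  0 <= dyadic_entropy_bound p.
Proof.
move=> p0 p1; rewrite /dyadic_entropy_bound divr_ge0 ?(ltW ln2_gt0)//.
do 2 (rewrite mulr_ge0 ?(ltW p0)//).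
have := ln_le0 p1; have := ln2_gt0; lra.
Qed.

(** The left side equals 3 + 1 / ln 2, and ln 2 >= 2/3. *)
Lemma dyadic_entropy_bound14 : 2 * dyadic_entropy_bound (1 / 4) <= 9 / 2.
Proof.
rewrite /dyadic_entropy_bound.
have -> : ln (1 / 4) = - (2 * ln 2) :> R.
  have -> : 1 / 4 = (2 ^+ 2)^-1 :> R by lra.
  by rewrite lnV ?posrE ?exprn_gt0// lnXn// mulr_natl.
rewrite mulrA ler_pdivrMr ?ln2_gt0//.
have := ln2_ge23; lra.
Qed.

(** The left side is (2/3)(2 + (1 + ln 3) / ln 2) <= (2/3)(2 + 3/2 + 8/5) = 3.4. *)
Lemma dyadic_entropy_bound16 : 2 * dyadic_entropy_bound (1 / 6) <= 7 / 2.
Proof.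
rewrite /dyadic_entropy_bound.
have -> : ln (1 / 6) = - (ln 2 + ln 3) :> R.
  have -> : 1 / 6 = (2 * 3)^-1 :> R by lra.
  by rewrite lnV ?posrE ?mulr_gt0// lnM ?posrE.
rewrite mulrA ler_pdivrMr ?ln2_gt0//.
have := ln2_ge23; have := ln3_le; lra.
Qed.

(** * Upper bounds on the binary entropy *)

Lemma binary_entropyE p :
  binary_entropy p = (- (p * ln p) - (1 - p) * ln (1 - p)) / ln 2.
Proof. by rewrite /binary_entropy /log2 !mulrA -mulNr -mulrBl. Qed.

Lemma binary_entropy_le1 p : 0 <= p -> p <= 1 / 2 -> binary_entropy p <= 1.
Proof.
move=> p0 p2; rewrite binary_entropyE ler_pdivrMr ?ln2_gt0// mul1r.
move: p0; rewrite le_eqVlt => /predU1P[<-|p0].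
  by rewrite mul0r subr0 ln1 mulr0 subr0 oppr0 ltW// ln2_gt0.
(* Tangent line of -q ln q at q = 1/2. Added for p and 1 - p, the right sides give exactly ln 2. *)
have h q : 0 < q -> - (q * ln q) <= q * ln 2 + 1 / 2 - q.
  move=> q0; have := @ln_le_subr1 (q * 2)^-1.
  rewrite invr_gt0 mulr_gt0// => /(_ isT).
  rewrite lnV ?posrE ?mulr_gt0// lnM ?posrE// => h.
  have : q * (- (ln q + ln 2)) <= q * ((q * 2)^-1 - 1).
    by apply: ler_wpM2l => //; exact: ltW.
  have -> : q * ((q * 2)^-1 - 1) = 1 / 2 - q by field; rewrite gt_eqF.
  lra.
have := h _ p0; have := h (1 - p); rewrite subr_gt0 => /(_ ltac:(lra)); lra.
Qed.

(** The term of 1 - p is at most p / ln 2, because ln (1 - p) >= 1 - 1/(1 - p); monotonicity of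
    [entropy_bound] then passes from p to q. *)
Lemma binary_entropy_le_bound p q : 0 <= p -> p <= q -> 0 < q -> q <= 1 / 2 ->
  binary_entropy p <= entropy_bound q.
Proof.
rewrite le_eqVlt => /predU1P[<-|p0] pq q0 q1.
  rewrite binary_entropyE mul0r subr0 ln1 mulr0 subr0 oppr0 mul0r.
  by apply: entropy_bound_ge0 => //; lra.
apply: le_trans (ler_entropy_bound p0 pq _); last lra.
rewrite binary_entropyE ler_pM2r ?invr_gt0 ?ln2_gt0//.
have h : 1 - (1 - p)^-1 <= ln (1 - p) by apply: subr1V_le_ln; lra.
have : (1 - p) * (1 - (1 - p)^-1) <= (1 - p) * ln (1 - p).
  by apply: ler_wpM2l => //; lra.
have -> : (1 - p) * (1 - (1 - p)^-1) = - p by field; rewrite gt_eqF; lra.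
lra.
Qed.

End real_estimates.

(** * The error probability of a level *)

Section gaussian_estimates.
Context {R : realType}.
Implicit Types p q x y a : R.

Local Notation mu := (@lebesgue_measure R).

Definition gauss_density x : R := (Num.sqrt (2 * pi))^-1 * expR (- (x ^+ 2 / 2)).

Lemma gauss_densityE x : normal_pdf 0 1 x = gauss_density x.
Proof.
rewrite normal_pdfE ?oner_eq0// /normal_peak /normal_fun /gauss_density.
by rewrite expr1n mul1r subr0 mulNr -[pi *+ 2]mulr_natl.
Qed.

Lemma gauss_density_gt0 x : 0 < gauss_density x.
Proof.
by rewrite mulr_gt0 ?expR_gt0// invr_gt0 sqrtr_gt0 mulr_gt0 ?pi_gt0.
Qed.

Lemma is_derive_gauss_density x :
  is_derive x 1 gauss_density (- (x * gauss_density x)).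
Proof.
rewrite /gauss_density; apply: is_derive_eq.
rewrite !scaler0 ?add0r /GRing.scale/=. lra.
Qed.

Lemma continuous_gauss_density : continuous gauss_density.
Proof.
move=> x; apply/differentiable_continuous/derivable1_diffP.
by have [] := is_derive_gauss_density x.
Qed.

Lemma cvg_gauss_density : gauss_density x @[x --> +oo] --> (0 : R).
Proof.
rewrite -[X in _ --> X](mulr0 (Num.sqrt (2 * pi))^-1).
apply: cvgMr.
(* From (x - 1)^2 >= 0, -x^2/2 <= -x + 1/2. *)
apply: (@squeeze_cvgr _ _ _ _ (fun=> 0) (fun x => expR (- x) * expR (1 / 2))).
- near=> x; rewrite expR_ge0/= -expRD ler_expR.
  have := sqr_ge0 (x - 1); nra.
- exact: cvg_cst.
- rewrite -[X in _ --> X](mul0r (expR (1 / 2))).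
  by apply: cvgMl; exact: cvgr_expR.
Unshelve. all: by end_near. Qed.

Lemma integral_id_mul_gauss_density y : 0 < y ->
  (\int[mu]_(x in `[y, +oo[) (x * gauss_density x)%:E)%E = (gauss_density y)%:E.
Proof.
move=> y0.
have dF x : is_derive x 1 (fun z => - gauss_density z) (x * gauss_density x).
  have h := is_derive_gauss_density x.
  by apply: is_derive_eq; rewrite opprK.
have cF : continuous (fun z => - gauss_density z).
  by move=> x; apply: cvgN; exact: continuous_gauss_density.
rewrite (@ge0_continuous_FTC2y _ _ (fun z => - gauss_density z) _ 0).
- by rewrite sub0e -EFinN opprK.
- move=> x yx; rewrite mulr_ge0 ?(ltW (gauss_density_gt0 _))//.
  by apply: le_trans yx; exact: ltW.
- apply: continuous_subspaceT => x.
  by apply: cvgM; [exact: cvg_id|exact: continuous_gauss_density].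
- by rewrite -[X in _ --> X]oppr0; apply: cvgN; exact: cvg_gauss_density.
- by move=> x _; have [] := dF x.
- by apply: cvg_at_right_filter; exact: cF.
- by move=> x _; rewrite derive1E; have [_] := dF x.
Qed.

Lemma gaussQ_ge0 y : 0 <= gaussQ y.
Proof. by rewrite fine_ge0. Qed.

(* Mills' ratio bound: on [y, oo) the density is at most [(x / y)] times
   itself, and [x * density] has an explicit primitive. *)
Lemma gaussG_le0 y : 0 < y -> gaussG y <= 0.
Proof.
move=> y0; rewrite /gaussG subr_le0 -/(gauss_density y).
have fQ : normal_prob (0 : R) 1 `[y, +oo[ \is a fin_num.
  exact: fin_num_measure.
rewrite -lee_fin EFinM fineK// -integral_id_mul_gauss_density//.
rewrite /normal_prob -ge0_integralZl//=; last 3 first.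
- apply/measurable_EFinP/measurable_funTS; exact: measurable_normal_pdf.
- by move=> x _; rewrite lee_fin normal_pdf_ge0.
- by rewrite lee_fin ltW.
apply: ge0_le_integral => //.
- by move=> x _; rewrite mule_ge0// lee_fin ?normal_pdf_ge0// ltW.
- apply/measurable_funeM/measurable_EFinP/measurable_funTS.
  exact: measurable_normal_pdf.
- apply/measurable_EFinP/measurable_funTS/measurable_funM => //.
  by apply: continuous_measurable_fun; exact: continuous_gauss_density.
- move=> x; rewrite /= in_itv/= andbT => yx.
  rewrite -EFinM lee_fin gauss_densityE ler_wpM2r//.
  by rewrite ltW ?gauss_density_gt0.
Qed.

Lemma gaussG0 : gaussG 0 = - gauss_density 0 :> R.
Proof. by rewrite /gaussG mul0r sub0r. Qed.

Lemma gaussG_ge_gaussG0 y : 0 <= y -> gaussG 0 <= gaussG y.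
Proof.
move=> y0; rewrite gaussG0 /gaussG -/(gauss_density y).
have : 0 <= y * gaussQ y by rewrite mulr_ge0 ?gaussQ_ge0.
have : gauss_density y <= gauss_density 0.
  rewrite ler_wpM2l ?invr_ge0 ?sqrtr_ge0// ler_expR.
  by have := sqr_ge0 y; lra.
lra.
Qed.

Lemma eps0_ge0 a : 0 <= a -> 0 <= eps0 a.
Proof.
move=> a0; rewrite /eps0; case: ifPn => // _.
by rewrite divr_ge0 ?sqrtr_ge0// subr_ge0 gaussG_ge_gaussG0// mulr_ge0 ?sqrtr_ge0.
Qed.

(** As G(2 sqrt a) <= 0, the numerator is at most -G(0) = 1 / sqrt (2 pi), and pi >= 3. *)
Lemma eps0_le a : 0 < a -> eps0 a <= (Num.sqrt (6 * a))^-1.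
Proof.
move=> a0; rewrite /eps0 gt_eqF//.
have sa0 : 0 < Num.sqrt a by rewrite sqrtr_gt0.
have -> : Num.sqrt (6 * a) = Num.sqrt 6 * Num.sqrt a by rewrite sqrtrM.
rewrite invfM ler_pM2r ?invr_gt0//.
have h6 : gauss_density 0 <= (Num.sqrt 6)^-1 :> R.
  rewrite /gauss_density expr0n/= mul0r oppr0 expR0 mulr1.
  rewrite lef_pV2 ?posrE ?sqrtr_gt0 ?mulr_gt0 ?pi_gt0//.
  by rewrite ler_sqrt ?mulr_ge0 ?pi_ge0//; have := @pi_ge3 R; lra.
have := @gaussG_le0 (2 * Num.sqrt a); rewrite mulr_gt0// => /(_ isT).
rewrite gaussG0; lra.
Qed.

Lemma H0_hat_ge0 a : 0 <= a -> 0 <= H0_hat a.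
Proof.
move=> a0; rewrite /H0_hat subr_ge0 binary_entropy_le1//.
- by rewrite /eps0_hat le_min eps0_ge0// andbT; lra.
- by rewrite /eps0_hat ge_min lexx.
Qed.

(** The threshold 2/3 is where [(6 a)^(-1/2)] reaches 1/2, the limit of validity of
    [binary_entropy_le_bound]. *)
Lemma H0_hat_ge a : 2 / 3 <= a ->
  1 - entropy_bound (Num.sqrt (6 * a))^-1 <= H0_hat a.
Proof.
move=> a1; have a0 : 0 < a by lra.
have s0 : 0 < Num.sqrt (6 * a) by rewrite sqrtr_gt0; lra.
rewrite /H0_hat lerD2l lerN2 binary_entropy_le_bound//.
- by rewrite /eps0_hat le_min eps0_ge0 ?(ltW a0)// andbT; lra.
- by rewrite /eps0_hat ge_min eps0_le// orbT.
- by rewrite invr_gt0.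
- rewrite mul1r lef_pV2 ?posrE//.
  have -> : 2 = Num.sqrt (2 ^+ 2) :> R by rewrite sqrtr_sqr ger0_norm.
  by rewrite ler_sqrt; nra.
Qed.

End gaussian_estimates.

(** * Closed convex hulls in the quadrant *)

Section downward_closed_hulls.
Context {R : realType}.
Implicit Types (A B U : set (R^o * R^o)) (r s : R^o * R^o).

Lemma conv_pairE (t : {i01 R}) (r s : convex_lmodType (R^o * R^o)%type) :
  conv t r s =
  (t%:num * r.1 + (1 - t%:num) * s.1, t%:num * r.2 + (1 - t%:num) * s.2).
Proof. by []. Qed.

(** Trades the interval-typed coefficients of [convex_set] for a real t with explicit bounds. *)
Lemma convex_set_pairP A :
  convex_set A <-> forall r s (t : R), 0 <= t -> t <= 1 -> A r -> A s ->
    A (t * r.1 + (1 - t) * s.1, t * r.2 + (1 - t) * s.2).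
Proof.
split=> [cA r s t t0 t1 Ar As|cA r s t].
  have t01 : 0 <= t <= 1 by rewrite t0.
  have tP : Itv.spec (@Itv.num_sem R) (Itv.Real `[0%Z, 1%Z]) t.
    rewrite /Itv.spec/= /Itv.num_sem/= in_itv/= t0 t1 !andbT.
    by rewrite num_real.
  have := cA r s (Itv.mk tP); rewrite !inE => /(_ Ar As).
  by rewrite conv_pairE.
by rewrite !inE => Ar As; rewrite conv_pairE; apply: cA.
Qed.

(** Balls of the product are open boxes. *)
Lemma closure_pairP A r :
  closure A r <-> forall e : R, 0 < e ->
    exists s, [/\ A s, `|r.1 - s.1| < e & `|r.2 - s.2| < e].
Proof.
split=> [cA e e0|cA B].
  have /cA[s [As [s1 s2]]] : nbhs r (ball r e) by exact: nbhsx_ballx.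
  by exists s.
rewrite -nbhs_ballE => -[e /= e0 rB].
have [s [As s1 s2]] := cA _ e0.
by exists s; split => //; apply: rB.
Qed.

Lemma convex_hull_convex U : convex_set (convex_hull U).
Proof.
apply/convex_set_pairP => r s t t0 t1 Ur Us B [cB UB].
have /convex_set_pairP := cB; apply => //.
- exact: Ur.
- exact: Us.
Qed.

Lemma subset_convex_hull U : U `<=` convex_hull U.
Proof. exact: sub_gen_smallest. Qed.

Lemma convex_hull_sub U B : convex_set B -> U `<=` B -> convex_hull U `<=` B.
Proof. exact: smallest_sub. Qed.

(** * Downward closed subsets of the quadrant *)

Definition downward_closed A :=
  forall r s, 0 <= s.1 <= r.1 -> 0 <= s.2 <= r.2 -> A r -> A s.

Definition nonneg_quadrant : set (R^o * R^o) := [set r | 0 <= r.1 /\ 0 <= r.2].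

(** Scaling each coordinate by a factor in [0, 1] is linear and contracts distances, so this form
    passes easily to convex hulls and closures. *)
Lemma downward_closedP A :
  A `<=` nonneg_quadrant ->
  downward_closed A <->
  forall r (a b : R), 0 <= a <= 1 -> 0 <= b <= 1 -> A r -> A (a * r.1, b * r.2).
Proof.
move=> A0; split=> [dA r a b /andP[a0 a1] /andP[b0 b1] Ar|dA r s].
  have [r1 r2] := A0 _ Ar.
  by apply: dA Ar => /=; rewrite mulr_ge0//= ler_piMl.
have scale (x y : R) : 0 <= y <= x -> exists2 a, 0 <= a <= 1 & y = a * x.
  move=> /andP[y0 yx]; have [x0|x0] := eqVneq x 0.
    by exists 0; rewrite ?lexx ?ler01//; lra.
  have xgt0 : 0 < x by rewrite lt_neqAle eq_sym x0/=; lra.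
  exists (y / x); last by rewrite divfK.
  by rewrite divr_ge0 ?(ltW xgt0)//= ler_pdivrMr// mul1r.
move=> /scale[a a01 s1] /scale[b b01 s2] Ar.
by rewrite (surjective_pairing s) s1 s2; apply: dA.
Qed.

Lemma nonneg_quadrant_convex : convex_set nonneg_quadrant.
Proof.
apply/convex_set_pairP => r s t t0 t1 [r1 r2] [s1 s2].
by split; rewrite addr_ge0// mulr_ge0// subr_ge0.
Qed.

Lemma convex_hull_nonneg U :
  U `<=` nonneg_quadrant -> convex_hull U `<=` nonneg_quadrant.
Proof. exact: convex_hull_sub nonneg_quadrant_convex. Qed.

Lemma closure_nonneg A : A `<=` nonneg_quadrant -> closure A `<=` nonneg_quadrant.
Proof.
move=> A0 r /closure_pairP cA.
have h (x : R) : (forall e : R, 0 < e -> - e < x) -> 0 <= x.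
  move=> hx; rewrite leNgt; apply/negP => x0.
  by have := hx (- x); rewrite oppr_gt0 opprK ltxx => /(_ x0).
split; apply: h => e e0; have [s [/A0[s1 s2]]] := cA _ e0;
  rewrite !ltr_norml => /andP[? _] /andP[? _]; lra.
Qed.

(** The preimage of the hull under a coordinate scaling is convex and contains U, hence contains the
    hull. *)
Lemma convex_hull_downward_closed U :
  U `<=` nonneg_quadrant -> downward_closed U -> downward_closed (convex_hull U).
Proof.
move=> U0 dU; apply/downward_closedP; first exact: convex_hull_nonneg.
move=> r a b a01 b01.
pose B : set (R^o * R^o) := [set r | convex_hull U (a * r.1, b * r.2)].
apply: (@convex_hull_sub U B); last first.
  move=> u Uu; apply: subset_convex_hull.
  by move/downward_closedP: dU; apply.
apply/convex_set_pairP => u v t t0 t1 Bu Bv; rewrite /B/=.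
have /convex_set_pairP := @convex_hull_convex U.
move=> /(_ _ _ _ t0 t1 Bu Bv); congr (convex_hull U (_, _)) => /=; ring.
Qed.

Lemma closure_downward_closed A :
  A `<=` nonneg_quadrant -> downward_closed A -> downward_closed (closure A).
Proof.
move=> A0 dA; apply/downward_closedP; first exact: closure_nonneg.
move=> r a b /[dup] a01 /andP[a0 a1] /[dup] b01 /andP[b0 b1] /closure_pairP cA.
apply/closure_pairP => e e0; have [s [As s1 s2]] := cA _ e0.
exists (a * s.1, b * s.2); split=> /=.
- by move/downward_closedP: dA; apply.
- by rewrite -mulrBr normrM ger0_norm//; apply: le_lt_trans s1; rewrite ler_piMl.
- by rewrite -mulrBr normrM ger0_norm//; apply: le_lt_trans s2; rewrite ler_piMl.
Qed.

Lemma norm_avg_lt (t e x y u v : R) : 0 <= t -> t <= 1 ->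
  `|x - u| < e -> `|y - v| < e ->
  `|t * x + (1 - t) * y - (t * u + (1 - t) * v)| < e.
Proof.
move=> t0 t1 xu yv.
have -> : t * x + (1 - t) * y - (t * u + (1 - t) * v) =
  t * (x - u) + (1 - t) * (y - v) by ring.
apply: le_lt_trans (ler_normD _ _) _; rewrite !normrM ger0_norm//.
rewrite [`|1 - t|]ger0_norm ?subr_ge0//.
(* For t = 0 the strict inequality must come from the second term; otherwise the first one supplies
   it. *)
have [t0'|t0'] := eqVneq t 0; first by rewrite t0' mul0r subr0 mul1r add0r.
have tgt0 : 0 < t by rewrite lt_neqAle eq_sym t0' t0.
have : 0 <= (1 - t) * (e - `|y - v|) by rewrite mulr_ge0// subr_ge0// ltW.
have : 0 < t * (e - `|x - u|) by rewrite mulr_gt0// subr_gt0.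
lra.
Qed.

Lemma closure_convex A : convex_set A -> convex_set (closure A).
Proof.
move=> /convex_set_pairP cA; apply/convex_set_pairP => r s t t0 t1.
move=> /closure_pairP clr /closure_pairP cls; apply/closure_pairP => e e0.
have [u [Au u1 u2]] := clr _ e0; have [v [Av v1 v2]] := cls _ e0.
exists (t * u.1 + (1 - t) * v.1, t * u.2 + (1 - t) * v.2); split=> /=.
- exact: cA.
- exact: norm_avg_lt u1 v1.
- exact: norm_avg_lt u2 v2.
Qed.

Lemma max0_shift_convex (g t x y : R) : 0 <= t -> t <= 1 ->
  Num.max 0 (t * x + (1 - t) * y - g) <=
  t * Num.max 0 (x - g) + (1 - t) * Num.max 0 (y - g).
Proof.
move=> t0 t1; have t1' : 0 <= 1 - t by rewrite subr_ge0.
have h (z : R) : 0 <= Num.max 0 z by rewrite le_max lexx.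
have h' (z : R) : z <= Num.max 0 z by rewrite le_max lexx orbT.
rewrite ge_max addr_ge0 ?mulr_ge0//=.
have := ler_wpM2l t0 (h' (x - g)); have := ler_wpM2l t1' (h' (y - g)); lra.
Qed.

Lemma max0_shift_dist (g x y : R) :
  `|Num.max 0 (x - g) - Num.max 0 (y - g)| <= `|x - y|.
Proof.
have h := ler_norm (x - y); have h' := ler_norm (y - x); rewrite distrC in h'.
by have [?|?] := leP 0 (x - g); have [?|?] := leP 0 (y - g);
   rewrite ler_norml; apply/andP; split; lra.
Qed.

(* [x |-> (x - g)^+] is convex and 1-Lipschitz. *)
Lemma gap_closure_convex_hull (g : R) (U V : set (R^o * R^o)) :
  V `<=` nonneg_quadrant -> downward_closed V ->
  (forall r, U r ->
    closure (convex_hull V) (Num.max 0 (r.1 - g), Num.max 0 (r.2 - g))) ->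
  forall r, closure (convex_hull U) r ->
    closure (convex_hull V) (Num.max 0 (r.1 - g), Num.max 0 (r.2 - g)).
Proof.
move=> V0 dV UV r.
have H0 := convex_hull_nonneg V0.
have dH := closure_downward_closed H0 (convex_hull_downward_closed V0 dV).
have /convex_set_pairP cH := closure_convex (@convex_hull_convex V).
have hull s : convex_hull U s ->
    closure (convex_hull V) (Num.max 0 (s.1 - g), Num.max 0 (s.2 - g)).
  pose B : set (R^o * R^o) := [set s |
    closure (convex_hull V) (Num.max 0 (s.1 - g), Num.max 0 (s.2 - g))].
  apply: (@convex_hull_sub U B) => //.
  apply/convex_set_pairP => u v t t0 t1 Bu Bv; rewrite /B/=.
  (* Convexity of the positive part gives only an inequality in each coordinate; downward closure
     absorbs it. *)
  by apply: (dH _ _ _ _ (cH _ _ _ t0 t1 Bu Bv)) => /=;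
    rewrite le_max lexx/= max0_shift_convex.
move=> /closure_pairP cU.
(* The target is closed, so approximation by its own points suffices. *)
rewrite ((closure_id _).1 (@closed_closure _ (convex_hull V))).
apply/closure_pairP => e e0; have [s [Us s1 s2]] := cU _ e0.
exists (Num.max 0 (s.1 - g), Num.max 0 (s.2 - g)); split=> /=.
- exact: hull.
- exact: le_lt_trans (max0_shift_dist _ _ _) s1.
- exact: le_lt_trans (max0_shift_dist _ _ _) s2.
Qed.

End downward_closed_hulls.

(** * Time sharing *)

Section time_sharing.
Context {R : realType} {d : measure_display} {T : measurableType d}.
Context {P : probability T R}.
Implicit Types (S : {RV P >-> R}) (alpha a b : nat -> R).

(** The set whose closed convex hull is [achievable_region]. *)
Definition superposition_union S1 S2 : set (R^o * R^o) :=
  \bigcup_(N in [set N : set nat * set nat |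
      N.1 `|` N.2 = [set n | (0 < n)%N] /\ N.1 `&` N.2 = set0])
    rate_rectangle (superposition_rate S1 N.1) (superposition_rate S2 N.2).

Lemma superposition_union_nonneg S1 S2 :
  superposition_union S1 S2 `<=` nonneg_quadrant.
Proof. by move=> r [N _ []]. Qed.

Lemma superposition_union_downward_closed S1 S2 :
  downward_closed (superposition_union S1 S2).
Proof.
move=> r s /andP[s1 rs1] /andP[s2 rs2] [N NP [r1 r2 h1 h2]].
exists N => //; split => //.
- by apply: le_trans h1; rewrite lee_fin.
- by apply: le_trans h2; rewrite lee_fin.
Qed.

(** [esum] is a supremum over finite subsets, and s is one of them. *)
Lemma superposition_rate_ge S (A : set nat) (s : seq nat) a :
  uniq s -> (forall n, n \in s -> A n) ->
  (forall n, A n -> ((a n)%:E <= level_rate S n)%E) ->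
  ((2 * \sum_(n <- s) a n)%:E <= superposition_rate S A)%E.
Proof.
move=> us sA aS; rewrite /superposition_rate EFinM lee_pmul2l//.
apply: esum_ge; exists [set` s].
  by split => //; exact: finite_seq.
rewrite -fsbig_seq// -sumEFin.
rewrite [leLHS]big_seq [leRHS]big_seq.
by apply: lee_sum => n /sA; exact: aS.
Qed.

(** Shares in {0, 1} define a partition: user 1 gets the levels of share 1. Levels above N are
    allotted too, but left out of the bound. *)
Lemma pure_time_sharing S1 S2 alpha a b N :
  (forall n, alpha n = 0 \/ alpha n = 1) ->
  (forall n, 0 <= a n) -> (forall n, 0 <= b n) ->
  (forall n, (0 < n)%N -> ((a n)%:E <= level_rate S1 n)%E) ->
  (forall n, (0 < n)%N -> ((b n)%:E <= level_rate S2 n)%E) ->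
  superposition_union S1 S2
    (2 * \sum_(1 <= n < N.+1) alpha n * a n,
     2 * \sum_(1 <= n < N.+1) (1 - alpha n) * b n).
Proof.
move=> alpha01 a0 b0 aS bS.
exists ([set n | (0 < n)%N && (alpha n == 1)],
        [set n | (0 < n)%N && (alpha n != 1)]).
  split; apply/seteqP; split=> n //=.
  - by case=> /andP[].
  - by move=> ->; case: eqP => _; [left|right].
  - by case=> /andP[_ ->] /andP[].
have sum1 : \sum_(1 <= n < N.+1) alpha n * a n =
    \sum_(n <- [seq n <- index_iota 1 N.+1 | alpha n == 1]) a n.
  rewrite big_filter [RHS]big_mkcond; apply: eq_bigr => n _.
  by case: (alpha01 n) => ->; rewrite ?eqxx ?mul1r// mul0r eq_sym oner_eq0.
have sum2 : \sum_(1 <= n < N.+1) (1 - alpha n) * b n =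
    \sum_(n <- [seq n <- index_iota 1 N.+1 | alpha n != 1]) b n.
  rewrite big_filter [RHS]big_mkcond; apply: eq_bigr => n _.
  case: (alpha01 n) => ->; rewrite ?eqxx ?subrr ?mul0r//.
  by rewrite subr0 mul1r eq_sym oner_eq0.
split => /=; rewrite ?sum1 ?sum2 ?mulr_ge0 ?sumr_ge0//.
- apply: superposition_rate_ge; first by rewrite filter_uniq// iota_uniq.
    by move=> n; rewrite mem_filter mem_index_iota => /andP[an /andP[n0 _]]; apply/andP.
  by move=> n /andP[n0 _]; exact: aS.
- apply: superposition_rate_ge; first by rewrite filter_uniq// iota_uniq.
    by move=> n; rewrite mem_filter mem_index_iota => /andP[an /andP[n0 _]]; apply/andP.
  by move=> n /andP[n0 _]; exact: bS.
Qed.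

(* The point is affine in each share, so the shares can be rounded to 0 or 1
   one at a time; [k] bounds the levels whose share is still fractional. *)
Lemma time_sharing S1 S2 alpha a b N :
  (forall n, 0 <= alpha n <= 1) ->
  (forall n, 0 <= a n) -> (forall n, 0 <= b n) ->
  (forall n, (0 < n)%N -> ((a n)%:E <= level_rate S1 n)%E) ->
  (forall n, (0 < n)%N -> ((b n)%:E <= level_rate S2 n)%E) ->
  convex_hull (superposition_union S1 S2)
    (2 * \sum_(1 <= n < N.+1) alpha n * a n,
     2 * \sum_(1 <= n < N.+1) (1 - alpha n) * b n).
Proof.
move=> alphaP a0 b0 aS bS.
pose pt al : R^o * R^o := (2 * \sum_(1 <= n < N.+1) al n * a n,
  2 * \sum_(1 <= n < N.+1) (1 - al n) * b n).
suff frac k al : (forall n, 0 <= al n <= 1) ->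
    (forall n, (k <= n)%N -> al n = 0 \/ al n = 1) ->
    convex_hull (superposition_union S1 S2) (pt al).
  (* The sums stop at N, so the later shares may be reset to 0, leaving finitely many to round. *)
  pose al n := if (n <= N)%N then alpha n else 0.
  have -> : (2 * \sum_(1 <= n < N.+1) alpha n * a n,
     2 * \sum_(1 <= n < N.+1) (1 - alpha n) * b n) = pt al.
    congr (_ * _, _ * _); apply: eq_big_nat => n /andP[_ nN];
    by rewrite /al -ltnS nN.
  apply: (frac N.+1) => n.
    by rewrite /al; case: ifP => // _; rewrite lexx ler01.
  by rewrite /al ltnNge => /negbTE ->; left.
elim: k al => [|k ih] al al01 alk.
  by apply: subset_convex_hull; apply: pure_time_sharing => // n; exact: alk.
(* [al] is the average of [set_share 1] and [set_share 0] with weights [al k] and [1 - al k]. *)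
pose set_share c n : R := if n == k then c else al n.
have set_shareP c : c = 0 \/ c = 1 ->
    convex_hull (superposition_union S1 S2) (pt (set_share c)).
  move=> cP; apply: ih => n; rewrite /set_share; case: eqP => // nk.
    by case: cP => ->; rewrite ?lexx ler01.
  by move=> kn; apply: alk; rewrite ltn_neqAle kn eq_sym andbT; apply/eqP.
have /andP[t0 t1] := al01 k.
have /convex_set_pairP := @convex_hull_convex _ (superposition_union S1 S2).
move=> /(_ _ _ _ t0 t1 (set_shareP 1 (or_intror erefl)) (set_shareP 0 (or_introl erefl))).
congr (convex_hull _ (_, _)) => /=.
- rewrite ![al k * (2 * _)]mulrCA ![(1 - al k) * (2 * _)]mulrCA -mulrDr.
  congr (_ * _); rewrite !mulr_sumr -big_split/=; apply: eq_bigr => n _.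
  by rewrite /set_share; case: eqP => [->|_]; ring.
- rewrite ![al k * (2 * _)]mulrCA ![(1 - al k) * (2 * _)]mulrCA -mulrDr.
  congr (_ * _); rewrite !mulr_sumr -big_split/=; apply: eq_bigr => n _.
  by rewrite /set_share; case: eqP => [->|_]; ring.
Qed.

End time_sharing.

(** * Telescoping the losses *)

Section level_lower_bound.
Context {R : realType}.
Implicit Types x : R.

(* [(6 * (3 * x))^(-1/2)], the bound on [eps0 (3 * x)] given by [eps0_le] *)
Definition crossover x : R := (Num.sqrt (18 * x))^-1.

(** A monotone minorant of [H0_hat (3 * x)], cut to 0 below 1 so that its expectation at S / 4^n
    stays below Pr[S >= 4^n]. *)
Definition level_lower x : R :=
  if x < 1 then 0 else Num.max 0 (1 - entropy_bound (crossover x)).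

Lemma crossover_gt0 x : 0 < x -> 0 < crossover x.
Proof. by move=> x0; rewrite invr_gt0 sqrtr_gt0 mulr_gt0. Qed.

Lemma crossover_le x y : 0 < x -> x <= y -> crossover y <= crossover x.
Proof.
move=> x0 xy; have y0 : 0 < y by apply: lt_le_trans xy.
by rewrite lef_pV2 ?posrE ?sqrtr_gt0 ?mulr_gt0// ler_sqrt; nra.
Qed.

Lemma crossover_half : crossover (1 / 2) = 1 / 3.
Proof.
rewrite /crossover (_ : 18 * (1 / 2) = 3 ^+ 2); last lra.
by rewrite sqrtr_sqr ger0_norm// mul1r.
Qed.

Lemma crossover1 : crossover 1 <= 1 / 4.
Proof.
rewrite /crossover mulr1 mul1r lef_pV2 ?posrE ?sqrtr_gt0//.
have -> : 4 = Num.sqrt (4 ^+ 2) :> R by rewrite sqrtr_sqr ger0_norm.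
by rewrite ler_sqrt//; lra.
Qed.

Lemma crossover4 x : 0 <= x -> crossover (4 * x) = crossover x / 2.
Proof.
move=> x0; rewrite /crossover.
have -> : 18 * (4 * x) = 2 ^+ 2 * (18 * x) by ring.
by rewrite sqrtrM ?exprn_ge0// sqrtr_sqr ger0_norm// invfM mulrC.
Qed.

Lemma level_lower_ge0 x : 0 <= level_lower x.
Proof. by rewrite /level_lower; case: ifP => // _; rewrite le_max lexx. Qed.

Lemma level_lower_le1 x : level_lower x <= 1.
Proof.
rewrite /level_lower; case: ltP => // x1.
rewrite ge_max ler01/= gerBl entropy_bound_ge0//.
  by apply: crossover_gt0; lra.
have := crossover_le ltr01 x1; have := crossover1; lra.
Qed.

(** Provides the measurability of [level_lower]. *)
Lemma level_lower_nondecreasing : nondecreasing_fun level_lower.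
Proof.
move=> x y xy; rewrite {1}/level_lower; case: ltP => x1.
  exact: level_lower_ge0.
have y1 : 1 <= y by apply: le_trans xy.
rewrite /level_lower ltNge y1/= ge_max le_max lexx/= le_max.
apply/orP; right; rewrite lerD2l lerN2 ler_entropy_bound//.
- by apply: crossover_gt0; lra.
- by apply: crossover_le => //; lra.
- have := crossover_le ltr01 x1; have := crossover1; lra.
Qed.

Lemma level_lower_le_H0_hat x : 0 <= x -> level_lower x <= H0_hat (3 * x).
Proof.
move=> x0; rewrite /level_lower; case: ltP => x1.
  by apply: H0_hat_ge0; lra.
rewrite ge_max H0_hat_ge0; last lra.
apply: le_trans (@H0_hat_ge _ (3 * x) _); last lra.
by rewrite /crossover mulrA (_ : 6 * 3 = 18)//; lra.
Qed.

(* Bounds the loss summed over [x], [x / 4], [x / 16], ... *)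
Definition loss_potential x : R :=
  if x < 1 then 9 / 2 else 2 * dyadic_entropy_bound (crossover x).

Lemma loss_potential_ge0 x : 0 <= loss_potential x.
Proof.
rewrite /loss_potential; case: ltP => [_|x1]; first lra.
rewrite mulr_ge0// dyadic_entropy_bound_ge0//.
  by apply: crossover_gt0; lra.
have := crossover_le ltr01 x1; have := crossover1; lra.
Qed.

Lemma dyadic_entropy_bound_crossover_le x : 1 <= x ->
  2 * dyadic_entropy_bound (crossover x) <= 9 / 2.
Proof.
move=> x1; apply: le_trans (@dyadic_entropy_bound14 R).
rewrite ler_pM2l// ler_dyadic_entropy_bound//.
- by apply: crossover_gt0; lra.
- have := crossover_le ltr01 x1; have := crossover1; lra.
- lra.
Qed.

Lemma loss_potential_le x : loss_potential x <= 9 / 2.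
Proof.
rewrite /loss_potential; case: ltP => [//|].
exact: dyadic_entropy_bound_crossover_le.
Qed.

(** For x >= 1 the loss is at most twice [entropy_bound], which is exactly the drop of potential
    since multiplying x by 4 halves the crossover. Below 1 the constant 9/2 pays for the single
    octave that may still count. *)
Lemma level_loss_le x : 0 <= x ->
  (1 / 2 <= x)%R%:R + (1 <= x)%R%:R - 2 * level_lower x <=
  loss_potential x - loss_potential (4 * x).
Proof.
move=> x0; have [x1|x1] := leP 1 x.
  have -> : (1 / 2 <= x)%R by lra.
  rewrite /loss_potential /level_lower !ltNge x1/=.
  have -> : (1 <= 4 * x)%R by lra.
  rewrite /= crossover4// [X in _ <= _ * X - _]dyadic_entropy_boundE; last first.
    by apply: crossover_gt0; lra.
  have : 1 - entropy_bound (crossover x) <=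
    Num.max 0 (1 - entropy_bound (crossover x)) by rewrite le_max lexx orbT.
  move: (Num.max _ _) => m; lra.
rewrite /level_lower /loss_potential x1 mulr0 subr0 addr0.
have [x2|x2] := leP (1 / 2) x.
  have -> : (4 * x < 1) = false by apply/negbTE; rewrite -leNgt; lra.
  (* Here the crossover at 4x is at most half of 1/3, and 9/2 - 7/2 = 1 covers the loss. *)
  have : 2 * dyadic_entropy_bound (crossover (4 * x)) <= 7 / 2.
    apply: le_trans (@dyadic_entropy_bound16 R).
    rewrite ler_pM2l// ler_dyadic_entropy_bound//.
    - by apply: crossover_gt0; lra.
    - rewrite crossover4//; have := @crossover_le (1 / 2) x.
      rewrite crossover_half => /(_ ltac:(lra) x2); lra.
    - lra.
  rewrite /=; lra.
rewrite /=; case: ltP => [|x3]; first lra.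
have := dyadic_entropy_bound_crossover_le x3; lra.
Qed.

(** With x_n = s / 4^n one has 4 x_n = x_(n-1), so the sum telescopes to the potential at x_N, at
    most 9/2, minus the potential at s, which is nonnegative. *)
Lemma sum_level_loss_le (s : R) N : 0 <= s ->
  \sum_(1 <= n < N.+1)
    ((2 ^+ (2 * n).-1 <= s)%R%:R + (2 ^+ (2 * n) <= s)%R%:R) <=
  9 / 2 + \sum_(1 <= n < N.+1) 2 * level_lower (s * 2 ^- (2 * n)).
Proof.
move=> s0; pose x n := s * 2 ^- (2 * n).
have x0 n : 0 <= x n by rewrite mulr_ge0// invr_ge0 exprn_ge0.
have x4 n : 4 * x n.+1 = x n.
  rewrite /x mulnS exprD; field.
  by rewrite ?expf_neq0.
rewrite -lerBlDr -sumrB.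
apply: (@le_trans _ _ (\sum_(1 <= n < N.+1) (loss_potential (x n) - loss_potential (x n.-1)))).
  apply: ler_sum_nat => -[//|n] _.
  rewrite -(x4 n); apply: le_trans (level_loss_le (x0 _)).
  have e2 k : (2 ^+ k <= s) = (1 <= s * 2 ^- k).
    by rewrite ler_pdivlMr ?exprn_gt0// mul1r.
  have e1 : (2 ^+ (2 * n.+1).-1 <= s) = (1 / 2 <= x n.+1).
    rewrite /x ler_pdivlMr ?exprn_gt0// mulnS add2n/= mul1r; congr (_ <= _).
    by rewrite [in RHS]exprS mulKf.
  by rewrite e1 e2.
have : \sum_(1 <= n < N.+1) (loss_potential (x n) - loss_potential (x n.-1)) =
    loss_potential (x N) - loss_potential (x 0%N).
  by rewrite big_add1/= telescope_sumr.
move=> ->; have := loss_potential_le (x N); have := loss_potential_ge0 (x 0%N); lra.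
Qed.

End level_lower_bound.

(** * Expected loss of the levels *)

Section level_floor.
Context {R : realType} {d : measure_display} {T : measurableType d}.
Context {P : probability T R}.
Implicit Types S : {RV P >-> R}.

(* Only [f] needs to be measurable, unlike in [ge0_le_integral]. *)
Lemma ge0_le_integralT (f g : T -> \bar R) :
  (forall x, 0 <= f x)%E -> (forall x, f x <= g x)%E ->
  (\int[P]_x f x <= \int[P]_x g x)%E.
Proof.
move=> f0 fg; have g0 x : (0 <= g x)%E by apply: le_trans (fg x).
rewrite !ge0_integralTE//; apply: le_ereal_sup => _ [h hf <-].
by exists h => // x; apply: le_trans (fg x).
Qed.

Lemma measurable_level_lower S (c : R) :
  measurable_fun setT (fun t => level_lower (S t * c)).
Proof.
apply: (@measurableT_comp _ _ _ _ _ _ (@level_lower R)).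
  exact: nondecreasing_measurable level_lower_nondecreasing.
exact: measurable_funM.
Qed.

(** The integrand lies in [0, 1], so [fine] loses nothing. *)
Definition level_floor S n : R :=
  fine (\int[P]_t (level_lower (S t * 2 ^- (2 * n)))%:E)%E.

Lemma level_floor_ge0 S n : 0 <= level_floor S n.
Proof.
by rewrite fine_ge0// integral_ge0// => t _; rewrite lee_fin level_lower_ge0.
Qed.

Lemma level_floorE S n :
  (level_floor S n)%:E = (\int[P]_t (level_lower (S t * 2 ^- (2 * n)))%:E)%E.
Proof.
rewrite fineK// ge0_fin_numE; last first.
  by apply: integral_ge0 => t _; rewrite lee_fin level_lower_ge0.
apply: (@le_lt_trans _ _ (\int[P]_t (cst 1 t))%E).
  apply: ge0_le_integralT => t; first by rewrite lee_fin level_lower_ge0.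
  by rewrite lee_fin level_lower_le1.
rewrite integral_cst//.
by rewrite [X in (_ * X)%E](@probability_setT _ _ _ P) mule1 ltry.
Qed.

Lemma level_floor_le S n : (forall t, 0 <= S t) ->
  ((level_floor S n)%:E <= level_rate S n)%E.
Proof.
move=> S0; rewrite level_floorE /level_rate unlock.
apply: ge0_le_integralT => t; rewrite lee_fin ?level_lower_ge0//.
by rewrite -mulrA level_lower_le_H0_hat// mulr_ge0// invr_ge0 exprn_ge0.
Qed.

(** * Tails as expectations of indicators *)

Lemma tail_ge0 S x : (0 <= tail S x)%E.
Proof. exact: measure_ge0. Qed.

Lemma tail_le1 S x : (tail S x <= 1)%E.
Proof. exact: probability_le1. Qed.

Lemma tail_fin_num S x : tail S x \is a fin_num.
Proof. exact: fin_num_measure. Qed.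

Lemma tail_nonincreasing S x y : x <= y -> (tail S y <= tail S x)%E.
Proof.
move=> xy; apply: le_measure; rewrite ?inE//.
by move=> z; rewrite /= !in_itv/= !andbT; exact: le_trans.
Qed.

Lemma measurable_tail S (D : set R) : measurable D -> measurable_fun D (tail S).
Proof.
move=> mD; rewrite (_ : tail S = EFin \o (fine \o tail S)); last first.
  by apply/funext => x /=; rewrite fineK// tail_fin_num.
apply/measurable_EFinP; apply: nonincreasing_measurable => // x y xy.
by rewrite fine_le ?tail_fin_num// tail_nonincreasing.
Qed.

Lemma tail_indicatorE S (x : R) :
  (fun t => ((x <= S t)%R%:R : R)) = \1_(S @^-1` `[x, +oo[).
Proof.
apply/funext => t; rewrite indicE; congr (_%:R); congr nat_of_bool.
by apply/idP/idP; rewrite inE/= in_itv/= andbT.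
Qed.

Lemma measurable_tail_event S (x : R) : measurable (S @^-1` `[x, +oo[).
Proof. by rewrite -[X in measurable X]setTI; exact: measurable_funPT. Qed.

Lemma measurable_tail_indicator S (x : R) :
  measurable_fun setT (fun t => ((x <= S t)%R%:R : R)).
Proof.
by rewrite tail_indicatorE; apply: measurable_indic; exact: measurable_tail_event.
Qed.

Lemma integral_tail S (x : R) :
  (\int[P]_t ((x <= S t)%R%:R)%:E)%E = tail S x.
Proof.
transitivity (\int[P]_t (\1_(S @^-1` `[x, +oo[) t)%:E)%E.
  by rewrite -tail_indicatorE.
by rewrite integral_indic// ?setIT//; exact: measurable_tail_event.
Qed.

(** The expectation of [sum_level_loss_le] at s = S. *)
Lemma sum_tail_le S N : (forall t, 0 <= S t) ->
  \sum_(1 <= n < N.+1)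
    (fine (tail S (2 ^+ (2 * n).-1)) + fine (tail S (2 ^+ (2 * n)))) <=
  9 / 2 + 2 * \sum_(1 <= n < N.+1) level_floor S n.
Proof.
move=> S0; rewrite -lee_fin.
have mI (x : R) := measurable_tail_indicator S x.
pose f n t : \bar R := ((2 ^+ (2 * n).-1 <= S t)%R%:R + (2 ^+ (2 * n) <= S t)%R%:R)%:E.
pose g n t : \bar R := (2 * level_lower (S t * 2 ^- (2 * n)))%:E.
have mf n : measurable_fun setT (f n).
  by apply/measurable_EFinP; exact: measurable_funD.
have mg n : measurable_fun setT (g n).
  by apply/measurable_EFinP/measurable_funM => //; exact: measurable_level_lower.
have f0 n t : (0 <= f n t)%E by rewrite lee_fin addr_ge0.
have g0 n t : (0 <= g n t)%E by rewrite lee_fin mulr_ge0// level_lower_ge0.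
have -> : (\sum_(1 <= n < N.+1)
    (fine (tail S (2 ^+ (2 * n).-1)) + fine (tail S (2 ^+ (2 * n)))))%:E =
    (\int[P]_t \sum_(1 <= n < N.+1) f n t)%E.
  rewrite ge0_integral_sum// -sumEFin; apply: eq_bigr => n _.
  rewrite EFinD !fineK ?tail_fin_num// -!integral_tail -ge0_integralD//.
  - by apply/measurable_EFinP.
  - by apply/measurable_EFinP.
have -> : (9 / 2 + 2 * \sum_(1 <= n < N.+1) level_floor S n)%:E =
    (\int[P]_t (cst (9 / 2)%:E t + \sum_(1 <= n < N.+1) g n t))%E.
  rewrite ge0_integralD//; last 3 first.
  - by move=> t _; rewrite lee_fin; lra.
  - by move=> t _; apply: sume_ge0.
  - by apply: emeasurable_sum.
  rewrite integral_cst// [X in (_ * X)%E](@probability_setT _ _ _ P) mule1 EFinD; congr (_ + _)%E.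
  rewrite ge0_integral_sum// mulr_sumr -sumEFin; apply: eq_bigr => n _.
  rewrite EFinM level_floorE -ge0_integralZl//.
  - by apply/measurable_EFinP; exact: measurable_level_lower.
  - by move=> t _; rewrite lee_fin level_lower_ge0.
apply: ge0_le_integralT => t; first exact: sume_ge0.
by rewrite /f /g !sumEFin -EFinD lee_fin sum_level_loss_le.
Qed.

End level_floor.

(** * Splitting the outer rates into octaves *)

Section rate_splitting.
Context {R : realType}.
Local Notation mu := (@lebesgue_measure R).
Implicit Types (I J : set R).

Definition dyadic_itv (k : nat) : set R := `[2 ^+ k, 2 ^+ k.+1[%classic.

Lemma continuous_inv1D (x : R) : 0 <= x -> {for x, continuous (fun s : R => (1 + s)^-1)}.
Proof.
move=> x0; apply: cvgV; first by rewrite gt_eqF//; lra.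
by apply: cvgD; [exact: cvg_cst|exact: cvg_id].
Qed.

Lemma integral_inv1D (a b : R) : 0 <= a -> a < b ->
  (\int[mu]_(s in `[a, b]) ((1 + s)^-1)%:E = (ln (1 + b) - ln (1 + a))%:E)%E.
Proof.
move=> a0 ab.
have dF (x : R) : 0 <= x -> is_derive x 1 (fun s => ln (1 + s)) (1 + x)^-1.
  move=> x0; have hl : is_derive (1 + x) 1 (@ln R) (1 + x)^-1.
    by apply: is_derive1_ln; lra.
  have h1 : is_derive x 1 (fun s : R => 1 + s) 1.
    by rewrite -[X in is_derive _ _ _ X]add0r; exact: is_deriveD.
  rewrite -[(1 + x)^-1]mulr1.
  exact: (is_derive1_comp hl h1).
have cF (x : R) : 0 <= x -> {for x, continuous (fun s : R => ln (1 + s))}.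
  move=> x0; apply/differentiable_continuous/derivable1_diffP.
  by have [] := dF x x0.
rewrite (@continuous_FTC2 _ _ (fun s => ln (1 + s)))//.
- apply: continuous_in_subspaceT => x; rewrite inE/= in_itv/= => /andP[ax _].
  by apply: continuous_inv1D; lra.
- split.
  + move=> x; rewrite in_itv/= => /andP[ax _].
    by have [] := dF x (ltW (le_lt_trans a0 ax)).
  + by apply: cvg_at_right_filter; exact: cF.
  + by apply: cvg_at_left_filter; apply: cF; lra.
- move=> x; rewrite in_itv/= => /andP[ax _].
  by rewrite derive1E; have [_] := dF x (ltW (le_lt_trans a0 ax)).
Qed.

Lemma measurable_inv1D (D : set R) : measurable D -> D `<=` [set s | 0 <= s] ->
  measurable_fun D (fun s => ((1 + s)^-1)%:E).
Proof.
move=> mD D0; apply/measurable_EFinP.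
have m0 : measurable_fun (`[0, +oo[%classic : set R) (fun s : R => (1 + s)^-1).
  apply: subspace_continuous_measurable_fun => //.
  apply: continuous_in_subspaceT => x; rewrite inE/= in_itv/= andbT.
  exact: continuous_inv1D.
apply: measurable_funS m0 => // x /D0.
by rewrite /= in_itv/= andbT.
Qed.

Lemma inv1D_ge0 (s : R) : 0 <= s -> (0 <= ((1 + s)^-1)%:E)%E.
Proof. by move=> s0; rewrite lee_fin invr_ge0; lra. Qed.

Lemma le_integral_inv1D (D : set R) (a b : R) : measurable D ->
  D `<=` `[a, b] -> 0 <= a -> a < b ->
  (\int[mu]_(s in D) ((1 + s)^-1)%:E <= (ln (1 + b) - ln (1 + a))%:E)%E.
Proof.
move=> mD Dab a0 ab; rewrite -integral_inv1D//.
have ab0 : `[a, b] `<=` [set s : R | 0 <= s].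
  by move=> x; rewrite /= in_itv/= => /andP[ax _]; lra.
apply: ge0_subset_integral => //; first exact: measurable_inv1D.
by move=> x /ab0; exact: inv1D_ge0.
Qed.

Lemma dyadic_itv_ge0 k : dyadic_itv k `<=` [set s | 0 <= s].
Proof.
move=> x; rewrite /dyadic_itv/= in_itv/= => /andP[+ _].
by apply: le_trans; exact: exprn_ge0.
Qed.

Lemma measurable_dyadic_itv k : measurable (dyadic_itv k).
Proof. exact: measurable_itv. Qed.

(** The mass, in bits, that I has in octave k; it is finite for measurable I. *)
Definition octave_share I k : R :=
  fine ((log2 (expR 1))%:E *
    \int[mu]_(s in I `&` dyadic_itv k) ((1 + s)^-1)%:E)%E.

(** The whole octave has mass ln ((1 + 2^(k+1)) / (1 + 2^k)), and 1 + 2^(k+1) <= 2 (1 + 2^k). *)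
Lemma le_integral_octave I k : measurable I ->
  (\int[mu]_(s in I `&` dyadic_itv k) ((1 + s)^-1)%:E <= (ln 2)%:E)%E.
Proof.
move=> mI; have p0 : 0 < 2 ^+ k :> R by rewrite exprn_gt0.
apply: (@le_trans _ _ (ln (1 + 2 ^+ k.+1) - ln (1 + 2 ^+ k))%:E).
  apply: le_integral_inv1D.
  - by apply: measurableI => //; exact: measurable_dyadic_itv.
  - by move=> x [_]; rewrite /dyadic_itv/= !in_itv/= => /andP[-> /ltW ->].
  - exact: exprn_ge0.
  - by rewrite exprS; lra.
have p1 : 0 < 1 + 2 ^+ k :> R by lra.
have p2 : 0 < 1 + 2 ^+ k.+1 :> R by rewrite exprS; lra.
rewrite lee_fin lerBlDr -lnM ?posrE// ler_ln ?posrE ?mulr_gt0// exprS; lra.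
Qed.

Lemma integral_octave_ge0 I k :
  (0 <= \int[mu]_(s in I `&` dyadic_itv k) ((1 + s)^-1)%:E)%E.
Proof. by apply: integral_ge0 => x [_ /dyadic_itv_ge0]; exact: inv1D_ge0. Qed.

Lemma octave_shareE I k : measurable I ->
  (octave_share I k)%:E = ((log2 (expR 1))%:E *
    \int[mu]_(s in I `&` dyadic_itv k) ((1 + s)^-1)%:E)%E.
Proof.
move=> mI; rewrite fineK// fin_numM// ge0_fin_numE ?integral_octave_ge0//.
by apply: le_lt_trans (le_integral_octave k mI) _; rewrite ltry.
Qed.

Lemma log2_expR1_ge0 : 0 <= log2 (expR 1) :> R.
Proof. by rewrite log2_expR1 invr_ge0 ltW// ln2_gt0. Qed.

Lemma octave_share_ge0 I k : 0 <= octave_share I k.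
Proof.
by rewrite fine_ge0// mule_ge0 ?integral_octave_ge0// lee_fin log2_expR1_ge0.
Qed.

(** The shares of disjoint sets add up to that of their union, at most one bit. *)
Lemma octave_shareD_le1 I J k : measurable I -> measurable J ->
  [disjoint I & J] -> octave_share I k + octave_share J k <= 1.
Proof.
move=> mI mJ IJ; have mD := measurable_dyadic_itv k.
rewrite -lee_fin EFinD !octave_shareE// -ge0_muleDr ?integral_octave_ge0//.
rewrite -ge0_integral_setU; [|exact: measurableI|exact: measurableI| | |].
- rewrite -setIUl; apply: (@le_trans _ _ ((log2 (expR 1))%:E * (ln 2)%:E)%E).
    apply: lee_wpmul2l; first by rewrite lee_fin log2_expR1_ge0.
    by apply: le_integral_octave; exact: measurableU.
  by rewrite -EFinM lee_fin log2_expR1 mulVf// gt_eqF// ln2_gt0.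
- rewrite -setIUl; apply: measurable_inv1D.
    by apply: measurableI => //; exact: measurableU.
  by move=> x [_ /dyadic_itv_ge0].
- by rewrite -setIUl => x [_ /dyadic_itv_ge0]; exact: inv1D_ge0.
- apply/disj_setPS => x [[Ix _] [Jx _]].
  by move/disj_setPS: IJ => /(_ x); apply.
Qed.

(** * Truncating the outer rates to finitely many octaves *)

Definition initial_itv (k : nat) : set R := `[0, 2 ^+ k[%classic.

Lemma measurable_initial_itv k : measurable (initial_itv k).
Proof. exact: measurable_itv. Qed.

Context {d : measure_display} {T : measurableType d} {P : probability T R}.
Implicit Types S : {RV P >-> R}.

Lemma rate_integrand_ge0 S s : 0 <= s -> (0 <= tail S s * ((1 + s)^-1)%:E)%E.
Proof. by move=> s0; rewrite mule_ge0 ?tail_ge0 ?inv1D_ge0. Qed.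

Lemma measurable_rate_integrand S (D : set R) :
  measurable D -> D `<=` [set s | 0 <= s] ->
  measurable_fun D (fun s => tail S s * ((1 + s)^-1)%:E)%E.
Proof.
move=> mD D0; apply: emeasurable_funM; first exact: measurable_tail.
exact: measurable_inv1D.
Qed.

(** On [0, 2) the tail is at most 1, which costs log 3 <= 8/5; on each later octave it is at most
    its value at the left endpoint. *)
Lemma rate_log_integral_truncated_le I S M :
  measurable I -> I `<=` [set s | 0 <= s] ->
  (rate_log_integral (I `&` initial_itv M.+1) S <=
   (8 / 5 + \sum_(1 <= k < M.+1) octave_share I k * fine (tail S (2 ^+ k)))%:E)%E.
Proof.
move=> mI I0; have c0 := log2_expR1_ge0.
elim: M => [|M ih].
  rewrite big_geq// addr0 /rate_log_integral.
  apply: (@le_trans _ _ ((log2 (expR 1))%:E * (ln 3)%:E)%E); last first.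
    rewrite -EFinM lee_fin log2_expR1 mulrC ler_pdivrMr ?ln2_gt0//.
    exact: ln3_le.
  apply: lee_wpmul2l; first by rewrite lee_fin.
  have mI2 : measurable (I `&` initial_itv 1).
    by apply: measurableI => //; exact: measurable_initial_itv.
  have I20 : I `&` initial_itv 1 `<=` [set s | 0 <= s] by move=> x [/I0].
  apply: (@le_trans _ _ (\int[mu]_(s in I `&` initial_itv 1) ((1 + s)^-1)%:E)%E).
    apply: ge0_le_integral => //.
    - by move=> x /I20; exact: rate_integrand_ge0.
    - exact: measurable_rate_integrand.
    - exact: measurable_inv1D.
    - move=> x /I20 x0; rewrite -[leRHS]mul1e.
      by apply: lee_wpmul2r; [exact: inv1D_ge0|exact: tail_le1].
  apply: le_trans (@le_integral_inv1D _ 0 2 mI2 _ (lexx 0) _) _ => //.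
  - by move=> x [_]; rewrite /initial_itv/= expr1 !in_itv/= => /andP[-> /ltW ->].
  - by rewrite lee_fin addr0 ln1 subr0 (_ : 1 + 2 = 3)//; lra.
have mB := measurable_initial_itv.
have p0 : 0 < 2 ^+ M.+1 :> R by rewrite exprn_gt0.
have p1 : 2 ^+ M.+1 <= 2 ^+ M.+2 :> R by rewrite [leRHS]exprS; lra.
have mD := measurable_dyadic_itv M.+1.
have mIB : measurable (I `&` initial_itv M.+1) by exact: measurableI.
have mID : measurable (I `&` dyadic_itv M.+1) by exact: measurableI.
have Isplit : I `&` initial_itv M.+2 =
    (I `&` initial_itv M.+1) `|` (I `&` dyadic_itv M.+1).
  rewrite -setIUr; congr (_ `&` _); apply/seteqP; split => x;
    rewrite /dyadic_itv /initial_itv/= !in_itv/=.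
    move=> /andP[x0 x2]; have [x1|x1] := ltP x (2 ^+ M.+1).
      by left; rewrite x0.
    by right.
  case=> /andP[x0 x2]; apply/andP; split => //.
  - exact: lt_le_trans p1.
  - exact: le_trans (ltW p0) x0.
rewrite Isplit /rate_log_integral ge0_integral_setU; [|exact: mIB|exact: mID| | |].
- rewrite ge0_muleDr; last 2 first.
  + by apply: integral_ge0 => x [/I0 + _]; exact: rate_integrand_ge0.
  + by apply: integral_ge0 => x [/I0 + _]; exact: rate_integrand_ge0.
  rewrite big_nat_recr//= addrA EFinD; apply: leeD; first exact: ih.
  rewrite [leRHS]EFinM octave_shareE// fineK ?tail_fin_num// -muleA.
  apply: lee_wpmul2l; first by rewrite lee_fin.
  rewrite muleC -ge0_integralZl//; last 2 first.
  + by apply: (measurable_inv1D mID) => x [/I0].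
  + by move=> x [/I0 + _]; exact: inv1D_ge0.
  apply: ge0_le_integral.
  + exact: mID.
  + by move=> x [/I0 + _]; exact: rate_integrand_ge0.
  + by apply: (measurable_rate_integrand S mID) => x [/I0].
  + apply: emeasurable_funM => //.
    by apply: (measurable_inv1D mID) => x [/I0].
  + move=> x [/I0 x0]; rewrite /dyadic_itv/= in_itv/= => /andP[kx _].
    by apply: lee_wpmul2r; [exact: inv1D_ge0|exact: tail_nonincreasing].
- rewrite -Isplit; apply: measurable_rate_integrand; first exact: measurableI.
  by move=> x [/I0].
- by rewrite -Isplit => x [/I0 + _]; exact: rate_integrand_ge0.
- apply/disj_setPS => x [[_ +] [_]]; rewrite /dyadic_itv /initial_itv/= !in_itv/=.
  by move=> /andP[_ x1] /andP[x2 _]; have := lt_le_trans x1 x2; rewrite ltxx.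
Qed.

(** Monotone convergence along I cut at 2^M. The full rate may be infinite, hence the real r below
    it. *)
Lemma rate_log_integral_truncation I S (r e : R) :
  measurable I -> I `<=` [set s | 0 <= s] -> 0 < e ->
  (r%:E <= rate_log_integral I S)%E ->
  exists N, forall M, (N <= M)%N ->
    ((r - e)%:E <= rate_log_integral (I `&` initial_itv M) S)%E.
Proof.
move=> mI I0 e0 rI.
have mB := measurable_initial_itv.
pose F (i : nat) : set R := I `&` initial_itv i.
have mF i : measurable (F i) by exact: measurableI.
have F0 i : F i `<=` [set s | 0 <= s] by move=> x [/I0].
have ndF : nondecreasing_seq F.
  move=> m n mn; rewrite subsetEset => x [Ix]; rewrite /initial_itv/= in_itv/= => /andP[x0 xm].
  split => //; rewrite /initial_itv/= in_itv/= x0/=; apply: lt_le_trans xm _.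
  by rewrite ler_weXn2l//; lra.
have UF : \bigcup_i F i = I.
  apply/seteqP; split => [x [i _ []//]|x Ix].
  exists (Num.truncn x).+1 => //; split => //; rewrite /initial_itv/= in_itv/= (I0 _ Ix)/=.
  apply: lt_trans (truncnS_gt x) _; rewrite -natrX ltr_nat.
  exact: ltn_expl.
have f0 i x : F i x -> (0 <= tail S x * ((1 + x)^-1)%:E)%E.
  by move/F0; exact: rate_integrand_ge0.
have mf i : measurable_fun (F i) (fun s => tail S s * ((1 + s)^-1)%:E)%E.
  exact: measurable_rate_integrand.
have : (\int[mu]_(s in F i) (tail S s * ((1 + s)^-1)%:E))%E @[i --> \oo] -->
    (\int[mu]_(s in \bigcup_i F i) (tail S s * ((1 + s)^-1)%:E))%E.
  exact: ge0_nondecreasing_set_cvg_integral.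
rewrite UF => /(@cvgeZl _ _ _ _ _ (log2 (expR 1))%:E); rewrite fin_numE => /(_ isT).
rewrite -/(rate_log_integral I S) => cI.
have nd (m n : nat) : (m <= n)%N ->
    (rate_log_integral (F m) S <= rate_log_integral (F n) S)%E.
  move=> mn; apply: lee_wpmul2l; first by rewrite lee_fin log2_expR1_ge0.
  exact: ge0_nondecreasing_set_nondecreasing_integral.
(* If no N works, monotonicity keeps every truncated rate at most r - e, and so also the limit. *)
apply: contrapT => h.
suff : (rate_log_integral I S <= (r - e)%:E)%E.
  by move=> /(le_trans rI); rewrite lee_fin; lra.
rewrite -(cvg_lim _ cI)//; apply: lime_le; first by apply/cvg_ex; eexists; exact: cI.
near=> n; rewrite leNgt; apply/negP => hn; apply: h; exists n => M nM.
by apply: le_trans (ltW hn) _; exact: nd.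
Unshelve. all: by end_near. Qed.

Lemma measurable_outer_set1 S1 S2 (w : R) : measurable (outer_set1 S1 S2 w).
Proof.
rewrite (_ : outer_set1 _ _ _ = `[0, +oo[%classic `&`
    [set s | (w%:E * tail S2 s < tail S1 s)%E]); last first.
  by apply/seteqP; split => s; rewrite /outer_set1/= in_itv/= andbT.
apply: measurable_lte => //; last exact: measurable_tail.
by apply: emeasurable_funM => //; exact: measurable_tail.
Qed.

Lemma measurable_outer_set2 S1 S2 (w : R) : measurable (outer_set2 S1 S2 w).
Proof.
rewrite (_ : outer_set2 _ _ _ = `[0, +oo[%classic `&`
    [set s | (tail S1 s <= w%:E * tail S2 s)%E]); last first.
  by apply/seteqP; split => s; rewrite /outer_set2/= in_itv/= andbT.
apply: measurable_lee => //; first exact: measurable_tail.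
by apply: emeasurable_funM => //; exact: measurable_tail.
Qed.

Lemma outer_sets_disjoint S1 S2 (w : R) :
  [disjoint outer_set1 S1 S2 w & outer_set2 S1 S2 w].
Proof.
apply/disj_setPS => s [[_ s1] [_ s2]].
by have := lt_le_trans s1 s2; rewrite ltxx.
Qed.

End rate_splitting.

(** * The constant gap *)

Section constant_gap.
Context {R : realType} {d : measure_display} {T : measurableType d}.
Context {P : probability T R}.
Implicit Types S : {RV P >-> R}.

(** [level_lower] is at most 1 and vanishes below 1, so at S / 4^n it is below the indicator of S >=
    4^n. *)
Lemma level_floor_le_tail S n : level_floor S n <= fine (tail S (2 ^+ (2 * n))).
Proof.
rewrite -lee_fin level_floorE fineK ?tail_fin_num// -integral_tail.
apply: ge0_le_integralT => t; rewrite lee_fin ?level_lower_ge0//.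
have [h|h] := leP (2 ^+ (2 * n)) (S t); first exact: level_lower_le1.
by rewrite /level_lower ltr_pdivrMr ?exprn_gt0// mul1r h.
Qed.

Lemma sum_octaves (f : nat -> R) N :
  \sum_(1 <= k < (2 * N).+1) f k = \sum_(1 <= n < N.+1) (f (2 * n).-1 + f (2 * n)%N).
Proof.
elim: N => [|N ih]; first by rewrite muln0 !big_geq.
rewrite [RHS]big_nat_recr// -ih mulnS add2n succnK.
by rewrite [LHS]big_nat_recr//= [X in X + _ = _]big_nat_recr//= addrA.
Qed.

(** Halved because level n serves two octaves of at most one bit each. *)
Definition level_share (I : set R) n : R :=
  (octave_share I (2 * n).-1 + octave_share I (2 * n)) / 2.

Lemma level_share_bounds (I J : set R) n :
  measurable I -> measurable J -> [disjoint I & J] ->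
  0 <= level_share I n <= 1 /\ level_share J n <= 1 - level_share I n.
Proof.
move=> mI mJ IJ; rewrite /level_share.
have := octave_shareD_le1 (2 * n).-1 mI mJ IJ.
have := octave_shareD_le1 (2 * n) mI mJ IJ.
have := @octave_share_ge0 R I; have := @octave_share_ge0 R J.
move=> hJ hI; have := hI (2 * n)%N; have := hI (2 * n).-1.
have := hJ (2 * n)%N; have := hJ (2 * n).-1.
by move=> ? ? ? ? ? ?; split; [apply/andP; split|]; lra.
Qed.

(** Raising a share to 1 changes the loss by (1 - share) times (tail - floor), which is nonnegative;
    so the loss is at most that of full shares, bounded by [sum_tail_le]. *)
Lemma sum_octave_share_le S (I : set R) N : (forall t, 0 <= S t) ->
  (forall k, octave_share I k <= 1) ->
  \sum_(1 <= k < (2 * N).+1) octave_share I k * fine (tail S (2 ^+ k)) <=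
  9 / 2 + 2 * \sum_(1 <= n < N.+1) level_share I n * level_floor S n.
Proof.
move=> S0 I1; have := sum_tail_le N S0.
set A := \sum_(1 <= n < N.+1) _; set B := \sum_(1 <= n < N.+1) _ => AB.
rewrite sum_octaves -lerBlDr mulr_sumr -sumrB.
suff : \sum_(1 <= n < N.+1)
    (octave_share I (2 * n).-1 * fine (tail S (2 ^+ (2 * n).-1)) +
     octave_share I (2 * n) * fine (tail S (2 ^+ (2 * n))) -
     2 * (level_share I n * level_floor S n)) <= A - 2 * B by lra.
rewrite /A /B mulr_sumr -sumrB; apply: ler_sum_nat => n _.
have h2 := level_floor_le_tail S n.
have h1 : fine (tail S (2 ^+ (2 * n))) <= fine (tail S (2 ^+ (2 * n).-1)).
  rewrite fine_le ?tail_fin_num// tail_nonincreasing// ler_weXn2l ?leq_pred//; lra.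
have := I1 (2 * n)%N; have := I1 (2 * n).-1; rewrite /level_share.
move: (octave_share _ _) (octave_share _ _) (fine _) (fine _) (level_floor _ _) h1 h2.
move=> p q x y z h1 h2 p1 q1.
have : 0 <= (1 - p) * (y - z) by rewrite mulr_ge0//; lra.
have : 0 <= (1 - q) * (x - z) by rewrite mulr_ge0//; lra.
nra.
Qed.

Lemma rate_log_integral_gap S (I : set R) (r : R) :
  (forall t, 0 <= S t) -> measurable I -> I `<=` [set s | 0 <= s] ->
  (forall k, octave_share I k <= 1) -> (r%:E <= rate_log_integral I S)%E ->
  exists N0, forall N, (N0 <= N)%N ->
    r - (6 + 386 / 1000) <=
    2 * \sum_(1 <= n < N.+1) level_share I n * level_floor S n.
Proof.
move=> S0 mI I0 I1 rI.
(* The budget is 8/5 + 9/2 + 1/10 = 6.2 <= 6.386. *)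
have e0 : 0 < 1 / 10 :> R by lra.
have [N0 hN] := rate_log_integral_truncation mI I0 e0 rI.
(* Cutting at 2^(2N+1) keeps octaves 1 to 2N, those of levels 1 to N. *)
exists N0 => N N0N; have NM : (N0 <= (2 * N).+1)%N by lia.
have := le_trans (hN _ NM) (rate_log_integral_truncated_le S (2 * N) mI I0).
rewrite lee_fin; have := sum_octave_share_le N S0 I1; lra.
Qed.

Lemma max0_le_nneg (x y : R) : 0 <= y -> x <= y -> 0 <= Num.max 0 x <= y.
Proof. by move=> y0 xy; rewrite le_max lexx/= ge_max y0. Qed.

Lemma outer_rectangle_gap S1 S2 (w : R) (r : R^o * R^o) :
  (forall t, 0 <= S1 t) -> (forall t, 0 <= S2 t) ->
  rate_rectangle (rate_log_integral (outer_set1 S1 S2 w) S1)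
                 (rate_log_integral (outer_set2 S1 S2 w) S2) r ->
  convex_hull (superposition_union S1 S2)
    (Num.max 0 (r.1 - (6 + 386 / 1000)), Num.max 0 (r.2 - (6 + 386 / 1000))).
Proof.
move=> S10 S20 [r10 r20 r1 r2].
set I := outer_set1 S1 S2 w in r1; set J := outer_set2 S1 S2 w in r2.
have mI : measurable I by exact: measurable_outer_set1.
have mJ : measurable J by exact: measurable_outer_set2.
have IJ : [disjoint I & J] by exact: outer_sets_disjoint.
have I0 : I `<=` [set s | 0 <= s] by move=> s [].
have J0 : J `<=` [set s | 0 <= s] by move=> s [].
have I1 k : octave_share I k <= 1.
  by have := octave_shareD_le1 k mI mJ IJ; have := octave_share_ge0 J k; lra.
have J1 k : octave_share J k <= 1.
  by have := octave_shareD_le1 k mI mJ IJ; have := octave_share_ge0 I k; lra.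
have [N1 h1] := rate_log_integral_gap S10 mI I0 I1 r1.
have [N2 h2] := rate_log_integral_gap S20 mJ J0 J1 r2.
(* Both users must share the same finite set of levels. *)
pose N := maxn N1 N2.
have {}h1 := h1 N (leq_maxl _ _); have {}h2 := h2 N (leq_maxr _ _).
have share n := level_share_bounds n mI mJ IJ.
have hull : convex_hull (superposition_union S1 S2)
    (2 * \sum_(1 <= n < N.+1) level_share I n * level_floor S1 n,
     2 * \sum_(1 <= n < N.+1) (1 - level_share I n) * level_floor S2 n).
  apply: time_sharing => n; first by case: (share n).
  - exact: level_floor_ge0.
  - exact: level_floor_ge0.
  - by move=> _; exact: level_floor_le.
  - by move=> _; exact: level_floor_le.
(* User 2 receives all that user 1 leaves, at least its own share. *)
have h3 : 2 * \sum_(1 <= n < N.+1) level_share J n * level_floor S2 n <=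
    2 * \sum_(1 <= n < N.+1) (1 - level_share I n) * level_floor S2 n.
  rewrite ler_pM2l//; apply: ler_sum => n _.
  by rewrite ler_wpM2r ?level_floor_ge0//; case: (share n).
have dH := convex_hull_downward_closed (@superposition_union_nonneg _ _ _ _ S1 S2)
  (@superposition_union_downward_closed _ _ _ _ S1 S2).
apply: (dH _ _ _ _ hull) => /=; apply: max0_le_nneg.
- rewrite mulr_ge0// sumr_ge0// => n _; rewrite mulr_ge0 ?level_floor_ge0//.
  by case: (share n) => /andP[].
- exact: h1.
- rewrite mulr_ge0// sumr_ge0// => n _; rewrite mulr_ge0 ?level_floor_ge0//.
  by case: (share n) => /andP[_]; rewrite subr_ge0.
- exact: le_trans h3.
Qed.

End constant_gap.

Theorem mainTheorem3 (R : realType) (d : measure_display)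
    (T : measurableType d) (P : probability T R) (S1 S2 : {RV P >-> R})
    (S1_ge0 : forall t : T, 0 <= S1 t) (S2_ge0 : forall t : T, 0 <= S2 t)
    (R1 R2 : R) :
  outer_region S1 S2 (R1, R2) ->
  achievable_region S1 S2
    (Num.max 0 (R1 - (6 + 386 / 1000)), Num.max 0 (R2 - (6 + 386 / 1000))).
Proof.
apply: (@gap_closure_convex_hull R (6 + 386 / 1000) _ (superposition_union S1 S2)
  (@superposition_union_nonneg _ _ _ _ S1 S2)
  (@superposition_union_downward_closed _ _ _ _ S1 S2)).
move=> r [w _ rw]; apply: subset_closure; exact: outer_rectangle_gap rw.
Qed.
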